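(* (Restricted sum formula) For any positive integers $k,n,m$ with $k\ge n$, $$\sum_{\substack{k_1+\cdots+k_n=k\\ k_i\ge1}}\zeta^t(2mk_1,\ldots,2mk_n)=\left\{\sum_{i=1}^n\left[\sum_{j=0}^{k-i}\binom{k-j}{i}\sum_{\substack{n_0+\cdots+n_{m-1}=mj,\ l_0+\cdots+l_{m-1}=m(k-j)\\ n_p,l_p\ge0}}\prod_{p=0}^{m-1}\frac{\beta_{2n_p}}{(2n_p)!(2l_p+1)!}\,\rho_m^{\sum_{p=0}^{m-1}2p(n_p+l_p)}\right](-1)^i\binom{k-i}{k-n}t^{n-i}\right\}\frac{\lambda^{2km}}{4^{km}},$$ where $\rho_m=e^{\pi\sqrt{-1}/m}$, $\lambda=2\pi\sqrt{-1}$ and $\beta_{2l}=B_{2l}(2-4^l)$.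
   Context: $B_n$ are the Bernoulli numbers, $u/(e^u-1)=\sum_{n\ge0}B_nu^n/n!$; $t$ is a variable. For positive integers with $k_1\ge2$, $\zeta(k_1,\ldots,k_n)=\sum_{m_1>\cdots>m_n>0}\prod m_j^{-k_j}$ and the interpolated multiple zeta value is $\zeta^t(k_1,\ldots,k_n)=\sum_{\mathbf p}t^{n-\mathrm{dep}(\mathbf p)}\zeta(\mathbf p)$, summed over all sequences $\mathbf p$ obtained from $(k_1,\ldots,k_n)$ by replacing each separating comma by either a comma or a plus sign ($\mathrm{dep}$ = length). *)

(* Defs.v *)
From HB Require Import structures.
From mathcomp Require Import all_boot all_order all_algebra.
From mathcomp Require Import all_classical all_reals all_analysis.
From mathcomp Require Import complex.
Set Implicit Arguments. Unset Strict Implicit. Unset Printing Implicit Defensive.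
Import Order.TTheory GRing.Theory Num.Theory numFieldNormedType.Exports.
Local Open Scope ring_scope.

(* u/(e^u-1) = sum B_n u^n/n!  is equivalent (comparing coefficients in
   u = (e^u - 1) * sum B_n u^n/n!) to B_0 = 1 and
   sum_{j=0}^{n} 'C(n+1, j) B_j = 0 for n >= 1, i.e.
   B_{n+1} = - (sum_{j<=n} 'C(n+2, j) B_j) / (n+2).                       *)
Fixpoint bernoulli_seq (n : nat) : seq rat :=
  match n with
  | 0 => [:: 1]
  | n'.+1 =>
      let s := bernoulli_seq n' in
      rcons s (- (\sum_(j < n'.+1) ('C(n'.+2, j))%:R * nth 0 s j) / (n'.+2)%:R)
  end.

Definition bernoulli (n : nat) : rat := nth 0 (bernoulli_seq n) n.

Definition beta2 (l : nat) : rat := bernoulli (2 * l) * (2 - (4 ^ l)%:R).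

Fixpoint mzv_trunc {R : realType} (ks : seq nat) (N : nat) : R :=
  match ks with
  | [::] => 1
  | k :: ks' => \sum_(1 <= m < N.+1) (m%:R ^- k) * mzv_trunc ks' m.-1
  end.

Definition mzv {R : realType} (ks : seq nat) : R :=
  limn ((fun N : nat => @mzv_trunc R ks N) : R^nat).

(* merging: bit b_i = true means the i-th separating comma becomes a plus *)
Fixpoint mzv_merge (x : nat) (xs : seq nat) (bs : seq bool) : seq nat :=
  match xs, bs with
  | y :: ys, b :: bs' => if b then mzv_merge (x + y) ys bs'
                         else x :: mzv_merge y ys bs'
  | _, _ => [:: x]
  end.

Definition mzv_t {R : realType} (t : R[i]) (ks : seq nat) : R[i] :=
  match ks with
  | [::] => 1
  | x :: xs =>
      \sum_(b : (size xs).-tuple bool)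
        t ^+ (size ks - size (mzv_merge x xs b)) *
        ((@mzv R (mzv_merge x xs b))%:C)%C
  end.

Definition rho {R : realType} (m : nat) : R[i] :=
  (cos (pi / m%:R) +i* sin (pi / m%:R))%C.

Definition lambda {R : realType} : R[i] := ((0 : R) +i* (2 * pi))%C.

(* Main.v *)
Require Import Defs.
From HB Require Import structures.
From mathcomp Require Import all_boot all_order all_algebra.
From mathcomp Require Import all_classical all_reals all_analysis.
From mathcomp Require Import complex.
From mathcomp Require Import ring lra zify.
Import Order.TTheory GRing.Theory Num.Theory numFieldNormedType.Exports.
Local Open Scope ring_scope.
Set Implicit Arguments. Unset Strict Implicit. Unset Printing Implicit Defensive.

(** Put [A(w) = prod_r (1 - w / r^(2m))]. In [sum_(k,n) S(k,n) z^k y^n], where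
    [S(k,n)] is the left-hand side of the theorem, an integer [r] carrying a
    merged block contributes
    [sum_(d >= 1) t^(d-1) (y x / (1 - x))^d = y x / (1 - (1 + t y) x)] with
    [x = z / r^(2m)], so the generating series is
    [A((1 + t y - y) z) / A((1 + t y) z)]. Expanding the numerator around
    [1 + t y] gives the binomials, once the coefficients of [A] and [1 / A] are
    known. Since [A(v^m) = prod_(p < m) A_1(rho^(2p) v)], where
    [A_1(v) = prod_r (1 - v / r^2) = sin (pi sqrt v) / (pi sqrt v)], these come
    from the series of [sin x / x] and [x / sin x]. The coefficients of [A_1]
    are obtained elementarily: the elementary symmetric functions of
    [cot^2 (r pi / (2N+1))], [1 <= r <= N], are explicit binomials, and
    [cot^2 x <= 1 / x^2 <= 1 + cot^2 x]. The product formula holds already for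
    sums and products over [r <= N], by induction on [N]; then [N] tends to
    infinity coefficient by coefficient. *)

(** * Formal power series *)

Section FormalPowerSeries.
Variable A : comNzRingType.

Record fps := FPS { fps_coef :> nat -> A }.

HB.instance Definition _ := gen_eqMixin fps.
HB.instance Definition _ := gen_choiceMixin fps.

Implicit Types f g h : fps.

Lemma fpsP f g : f =1 g -> f = g.
Proof. by case: f g => [f] [g] /= /funext ->. Qed.

Definition fps_zero := FPS (fun=> 0).
Definition fps_one := FPS (fun n => (n == 0)%:R).
Definition fps_opp f := FPS (fun n => - f n).
Definition fps_add f g := FPS (fun n => f n + g n).
Definition fps_mul f g := FPS (fun n => \sum_(i < n.+1) f i * g (n - i)%N).

Fact fps_addA : associative fps_add.
Proof. by move=> f g h; apply: fpsP => n; apply: addrA. Qed.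

Fact fps_addC : commutative fps_add.
Proof. by move=> f g; apply: fpsP => n; apply: addrC. Qed.

Fact fps_add0 : left_id fps_zero fps_add.
Proof. by move=> f; apply: fpsP => n; apply: add0r. Qed.

Fact fps_addN : left_inverse fps_zero fps_opp fps_add.
Proof. by move=> f; apply: fpsP => n; apply: addNr. Qed.

HB.instance Definition _ :=
  GRing.isZmodule.Build fps fps_addA fps_addC fps_add0 fps_addN.

Definition fps_trunc f D : {poly A} := \poly_(i < D) f i.

Fact fps_mul_trunc f g D n :
  (n < D)%N -> fps_mul f g n = (fps_trunc f D * fps_trunc g D)`_n.
Proof.
move=> nD; rewrite coefM; apply: eq_bigr => i _.
by rewrite !coef_poly !ifT //; have := ltn_ord i; lia.
Qed.

Fact fps_mulC : commutative fps_mul.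
Proof.
move=> f g; apply: fpsP => n.
by rewrite !(@fps_mul_trunc _ _ n.+1) // mulrC.
Qed.

Fact fps_mulA : associative fps_mul.
Proof.
have mulE f g h n : fps_mul f (fps_mul g h) n =
    (fps_trunc f n.+1 * (fps_trunc g n.+1 * fps_trunc h n.+1))`_n.
  rewrite coefM; apply: eq_bigr => i _; rewrite coef_poly ltn_ord.
  by rewrite (@fps_mul_trunc _ _ n.+1) // ltnS leq_subr.
move=> f g h; apply: fpsP => n.
by rewrite [in RHS]fps_mulC !mulE mulrA mulrC.
Qed.

Fact fps_mul1 : left_id fps_one fps_mul.
Proof.
move=> f; apply: fpsP => n /=; rewrite big_ord_recl /= mul1r subn0.
by rewrite big1 ?addr0 // => i _; rewrite mul0r.
Qed.

Fact fps_mulDl : left_distributive fps_mul fps_add.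
Proof.
move=> f g h; apply: fpsP => n /=; rewrite -big_split.
by apply: eq_bigr => i _; apply: mulrDl.
Qed.

Fact fps_one_neq0 : fps_one != 0.
Proof. by apply/eqP => /(congr1 (fps_coef^~ 0)) /eqP; rewrite oner_eq0. Qed.

HB.instance Definition _ := GRing.Zmodule_isComNzRing.Build fps
  fps_mulA fps_mulC fps_mul1 fps_mulDl fps_one_neq0.

Lemma fps_coef1 n : (1 : fps) n = (n == 0)%:R.
Proof. by []. Qed.

Lemma fps_coefD f g n : (f + g) n = f n + g n.
Proof. by []. Qed.

Lemma fps_coefB f g n : (f - g) n = f n - g n.
Proof. by []. Qed.

Lemma fps_coefM f g n : (f * g) n = \sum_(i < n.+1) f i * g (n - i)%N.
Proof. by []. Qed.

Definition poly_fps (p : {poly A}) := FPS (fun n => p`_n).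

Fact poly_fps_is_zmod_morphism : zmod_morphism poly_fps.
Proof. by move=> p q; apply: fpsP => n; apply: coefB. Qed.

Fact poly_fps_is_monoid_morphism : monoid_morphism poly_fps.
Proof.
split; first by apply: fpsP => n; apply: coef1.
by move=> p q; apply: fpsP => n; apply: coefM.
Qed.

HB.instance Definition _ := GRing.isZmodMorphism.Build {poly A} fps poly_fps
  poly_fps_is_zmod_morphism.
HB.instance Definition _ := GRing.isMonoidMorphism.Build {poly A} fps poly_fps
  poly_fps_is_monoid_morphism.

Lemma fps_coefM1DcX f c n :
  (f * poly_fps (1 + c *: 'X)) n = f n + c * (if n is k.+1 then f k else 0).
Proof.
rewrite mulrC rmorphD rmorph1 mulrDl mul1r fps_coefD fps_coefM /=.
congr (_ + _).
case: n => [|n]; first by rewrite big_ord1 /= coefZ coefX mulr0 mul0r.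
rewrite big_ord_recl big_ord_recl big1 /= => [|i _]; last first.
  by rewrite coefZ coefX mulr0 mul0r.
by rewrite !coefZ !coefX mulr0 mul0r add0r mulr1 addr0 subSS subn0.
Qed.

Definition fps_scaleX (c : A) f := FPS (fun n => c ^+ n * f n).

Fact fps_scaleX_is_zmod_morphism c : zmod_morphism (fps_scaleX c).
Proof. by move=> f g; apply: fpsP => n; apply: mulrBr. Qed.

Fact fps_scaleX_is_monoid_morphism c : monoid_morphism (fps_scaleX c).
Proof.
split; first by apply: fpsP => -[|n]; rewrite /= ?mulr1 ?mulr0.
move=> f g; apply: fpsP => n /=; rewrite mulr_sumr; apply: eq_bigr => i _.
by rewrite mulrACA -exprD subnKC // -ltnS.
Qed.

HB.instance Definition _ c := GRing.isZmodMorphism.Build fps fps (fps_scaleX c)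
  (fps_scaleX_is_zmod_morphism c).
HB.instance Definition _ c := GRing.isMonoidMorphism.Build fps fps
  (fps_scaleX c) (fps_scaleX_is_monoid_morphism c).

Lemma fps_coef_scaleX c f n : fps_scaleX c f n = c ^+ n * f n.
Proof. by []. Qed.

Lemma fps_scaleX_X c : fps_scaleX c (poly_fps 'X) = poly_fps (c *: 'X).
Proof.
apply: fpsP => n; rewrite /= coefZ coefX.
by case: eqP => [->|]; rewrite ?expr1 ?mulr0.
Qed.

Lemma fps_coef_prod m (F : 'I_m -> fps) D :
  (\prod_(p < m) F p) D =
  \sum_(c : {ffun 'I_m -> 'I_D.+1} | (\sum_(p < m) (c p : nat))%N == D)
     \prod_(p < m) F p (c p).
Proof.
pose agree f g := forall n, (n <= D)%N -> f n = g n.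
have agreeM f f' g g' : agree f f' -> agree g g' -> agree (f * g) (f' * g').
  move=> ff' gg' n nD; apply: eq_bigr => i _.
  have iD : (i <= D)%N by rewrite (leq_trans _ nD) // -ltnS.
  by rewrite ff' ?gg' // (leq_trans (leq_subr _ _)).
have -> : (\prod_(p < m) F p) D = (\prod_(p < m) fps_trunc (F p) D.+1)`_D.
  transitivity ((\prod_(p < m) poly_fps (fps_trunc (F p) D.+1)) D).
    apply: (big_ind2 agree) => // p _ n nD.
    by rewrite /= coef_poly ltnS nD.
  by rewrite -rmorph_prod.
under eq_bigr do rewrite /fps_trunc poly_def.
rewrite bigA_distr_bigA coef_sum [RHS]big_mkcond; apply: eq_bigr => c _ /=.
rewrite scaler_prod coefZ prodrXr coefXn eq_sym.
by case: eqP; rewrite ?mulr1 ?mulr0.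
Qed.

End FormalPowerSeries.

Section MapFps.
Variables (A B : comNzRingType) (phi : {rmorphism A -> B}).

Definition map_fps (f : fps A) := FPS (phi \o f).

Lemma map_fps1 : map_fps 1 = 1.
Proof. by apply: fpsP => n; apply: rmorph_nat. Qed.

Lemma map_fpsM : {morph map_fps : f g / f * g}.
Proof.
move=> f g; apply: fpsP => n; rewrite /= rmorph_sum.
by apply: eq_bigr => i _; apply: rmorphM.
Qed.

End MapFps.

Section FpsConvergence.
Local Open Scope classical_set_scope.
Variable K : numFieldType.
Implicit Types (F G : nat -> fps K) (f g : fps K).

Definition fps_cvg F f := forall n, F N n @[N --> \oo] --> f n.

Lemma fps_cvgM F G f g :
  fps_cvg F f -> fps_cvg G g -> fps_cvg (fun N => F N * G N) (f * g).
Proof.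
move=> Ff Gg n; rewrite fps_coefM.
apply: cvg_big => [|i _]; first exact: add_continuous.
exact: cvgM.
Qed.

Lemma fps_cvg_prod (I : Type) (r : seq I) (F : I -> nat -> fps K)
    (f : I -> fps K) :
  (forall i, fps_cvg (F i) (f i)) ->
  fps_cvg (fun N => \prod_(i <- r) F i N) (\prod_(i <- r) f i).
Proof.
move=> Ff; elim: r => [|i r IHr].
  by rewrite big_nil => n; under eq_fun do rewrite big_nil; apply: cvg_cst.
by rewrite big_cons; under eq_fun do rewrite big_cons; apply: fps_cvgM.
Qed.

Lemma fps_cvg_scaleX (c : K) F f :
  fps_cvg F f -> fps_cvg (fun N => fps_scaleX c (F N)) (fps_scaleX c f).
Proof. by move=> Ff n; apply: cvgM (cvg_cst _) (Ff n). Qed.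

Lemma fps_cvg_unique F f g : fps_cvg F f -> fps_cvg F g -> f = g.
Proof.
move=> Ff Fg; apply: fpsP => n.
by apply: cvg_unique (Ff n) (Fg n).
Qed.

End FpsConvergence.

Lemma sum_multiples (V : nmodType) m k (F : nat -> V) : (0 < m)%N ->
  (forall i, ~~ (m %| i)%N -> F i = 0) ->
  \sum_(i < (m * k).+1) F i = \sum_(j < k.+1) F (m * j)%N.
Proof.
move=> m_gt0 F0; rewrite !big_ord_recr /=; congr (_ + _).
elim: k => [|k IHk]; first by rewrite muln0 !big_ord0.
rewrite big_ord_recr -IHk mulnS addnC big_split_ord /=; congr (_ + _).
case: m m_gt0 F0 {IHk} => // n _ F0.
rewrite big_ord_recl /= addn0 big1 ?addr0 // => i _; apply: F0.
by rewrite dvdn_addr ?dvdn_mulr // gtnNdvd // /bump; have := ltn_ord i; lia.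
Qed.

Section FpsSubstitution.
Variables (A : comNzRingType) (m : nat).
Implicit Types f g : fps A.

(* For [w] a primitive [m]-th root of unity this is a series in [X^m]. *)
Definition fps_twist (w : A) f := \prod_(p < m) fps_scaleX (w ^+ p) f.

Lemma fps_twistM w f g : fps_twist w (f * g) = fps_twist w f * fps_twist w g.
Proof. by rewrite -big_split; apply: eq_bigr => p _; rewrite rmorphM. Qed.

Lemma fps_twist1 w : fps_twist w 1 = 1.
Proof. by rewrite /fps_twist big1 // => p _; rewrite rmorph1. Qed.

Definition fps_multisection f := FPS (fun j => f (m * j)%N).

Lemma fps_multisectionM f g : (0 < m)%N ->
  (forall i, ~~ (m %| i)%N -> f i = 0) ->
  fps_multisection (f * g) = fps_multisection f * fps_multisection g.
Proof.
move=> m_gt0 f0; apply: fpsP => k; rewrite fps_coefM /=.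
rewrite (@sum_multiples _ m k (fun i => f i * g (m * k - i)%N)) // => [|i mi].
  by apply: eq_bigr => j _; rewrite mulnBr.
by rewrite f0 // mul0r.
Qed.

Lemma fps_multisection1 : (0 < m)%N -> fps_multisection 1 = 1.
Proof. by move=> m_gt0; apply: fpsP => k; rewrite /= muln_eq0 gtn_eqF. Qed.

End FpsSubstitution.

(** * Bernoulli numbers and the series of x / sinh x *)

Lemma sum_ord_double (V : nmodType) n (f : nat -> V) :
  \sum_(i < n.*2) f i = \sum_(j < n) (f j.*2 + f j.*2.+1).
Proof.
elim: n => [|n IHn]; first by rewrite !big_ord0.
by rewrite doubleS !big_ord_recr /= IHn addrA.
Qed.

Lemma size_bernoulli_seq n : size (bernoulli_seq n) = n.+1.
Proof. by elim: n => //= n IHn; rewrite size_rcons IHn. Qed.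

Lemma nth_bernoulli_seq n j :
  (j <= n)%N -> nth 0 (bernoulli_seq n) j = bernoulli j.
Proof.
elim: n => [|n IHn]; first by case: j.
rewrite leq_eqVlt => /orP[/eqP-> //|jn] /=.
by rewrite nth_rcons size_bernoulli_seq jn IHn.
Qed.

Lemma sum_bin_bernoulli n :
  \sum_(j < n) 'C(n, j)%:R * bernoulli j = (n == 1%N)%:R.
Proof.
case: n => [|[|n]]; first by rewrite big_ord0.
  by rewrite big_ord1 bin0 mul1r.
rewrite big_ord_recr /=.
have -> : bernoulli n.+1 =
    - (\sum_(j < n.+1) 'C(n.+2, j)%:R * bernoulli j) / n.+2%:R.
  rewrite /bernoulli /= nth_rcons size_bernoulli_seq ltnn eqxx.
  congr (- _ / _); apply: eq_bigr => j _.
  by rewrite nth_bernoulli_seq // -ltnS.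
by rewrite binSn mulrC divfK ?subrr // pnatr_eq0.
Qed.

Lemma invf_factM (F : numFieldType) i j :
  i`!%:R^-1 * j`!%:R^-1 = 'C(i + j, i)%:R / (i + j)`!%:R :> F.
Proof.
rewrite -(bin_fact (leq_addr j i)) addKn !natrM.
by field; rewrite !pnatr_eq0 -!lt0n !fact_gt0 bin_gt0 leq_addr.
Qed.

Definition exp_fps : fps rat := FPS (fun n => n`!%:R^-1).
Definition bernoulli_fps : fps rat := FPS (fun n => bernoulli n / n`!%:R).

Lemma exp_fpsD c d :
  fps_scaleX c exp_fps * fps_scaleX d exp_fps = fps_scaleX (c + d) exp_fps.
Proof.
apply: fpsP => n; rewrite fps_coefM /= addrC exprDn mulr_suml.
apply: eq_bigr => i _; have le_in : (i <= n)%N by rewrite -ltnS.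
by rewrite mulrACA invf_factM subnKC // -mulr_natr; ring.
Qed.

Lemma mul_bernoulli_fps : bernoulli_fps * (exp_fps - 1) = poly_fps 'X.
Proof.
apply: fpsP => n; rewrite fps_coefM big_ord_recr /= coefX subnn.
rewrite fact0 invr1 subrr mulr0 addr0.
transitivity ((\sum_(i < n) 'C(n, i)%:R * bernoulli i) / n`!%:R).
  rewrite mulr_suml; apply: eq_bigr => i _.
  rewrite subn_eq0 leqNgt ltn_ord subr0 -[LHS]mulrA.
  by rewrite invf_factM subnKC 1?ltnW //; ring.
by rewrite sum_bin_bernoulli; case: n => [|[|n]]; rewrite ?mul0r ?divr1.
Qed.

(* [x / sinh x = 2 B(x) - B(2x)] with [B(u) = u / (e^u - 1)]. *)
Lemma mul_bernoulli_sinh :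
  (bernoulli_fps *+ 2 - fps_scaleX 2 bernoulli_fps) *
    (exp_fps - fps_scaleX (- 1) exp_fps) = poly_fps 'X *+ 2.
Proof.
set B := bernoulli_fps; set E := exp_fps.
set B2 := fps_scaleX 2 B; set E' := fps_scaleX (- 1) E.
have scale1 (f : fps rat) : fps_scaleX 1 f = f.
  by apply: fpsP => n; rewrite /= expr1n mul1r.
have EE' : E * E' = 1.
  rewrite -[E in E * _]scale1 exp_fpsD subrr; apply: fpsP => n /=.
  by rewrite expr0n; case: n => [|n]; rewrite ?mul0r // divr1.
have B2E : B2 * (E * E - 1) = poly_fps 'X *+ 2.
  have -> : E * E = fps_scaleX 2 E by rewrite -[in LHS](scale1 E) exp_fpsD.
  have := congr1 (fps_scaleX 2) mul_bernoulli_fps.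
  rewrite rmorphM rmorphB rmorph1 /= fps_scaleX_X => ->.
  by rewrite scaler_nat rmorphMn.
transitivity (B * (E - 1) * ((E * E' + E') *+ 2) - B2 * (E * E - 1) * E'
    + (B *+ 2 - B2) * (1 - E * E') * E); first by ring.
by rewrite EE' B2E mul_bernoulli_fps subrr; ring.
Qed.

(* The expansions of [sinh x / x] and [x / sinh x] in powers of [x^2]. *)
Definition sinhc_fps : fps rat := FPS (fun l => l.*2.+1`!%:R^-1).
Definition cosechc_fps : fps rat := FPS (fun l => beta2 l / l.*2`!%:R).

Lemma mul_sinhc_cosechc : sinhc_fps * cosechc_fps = 1.
Proof.
rewrite mulrC; apply: fpsP => k; rewrite fps_coefM fps_coef1.
have := congr1 (fun f : fps rat => f k.*2.+1) mul_bernoulli_sinh.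
have -> : (poly_fps 'X *+ 2) k.*2.+1 = (k == 0)%:R * 2 :> rat.
  by rewrite -rmorphMn /= coefMn coefX eqSS double_eq0 mulr_natr.
rewrite fps_coefM -doubleS.
rewrite (@sum_ord_double _ k.+1 (fun i => _ i * _ (_ - i)%N)) => sinhE.
apply: (@mulIf _ 2) => //; rewrite -sinhE mulr_suml; apply: eq_bigr => j _.
have le_jk : (j <= k)%N by rewrite -ltnS.
have sinh_coef n :
    (exp_fps - fps_scaleX (- 1) exp_fps) n = (odd n)%:R * 2 / n`!%:R.
  by rewrite fps_coefB /= -signr_odd; case: odd => /=; ring.
rewrite !sinh_coef subSn ?leq_double // subSS -doubleB /= odd_double !mul0r.
have -> : 2 ^+ j.*2 = (4 ^ j)%:R :> rat by rewrite -mul2n exprM natrX.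
by rewrite mulr0 addr0 /beta2 mul2n /=; ring.
Qed.

(** * Elementary symmetric functions *)

Definition esym_poly (A : comNzRingType) (y : nat -> A) (N : nat) : {poly A} :=
  \prod_(r < N) (1 + y r *: 'X).

Lemma esym_poly0 (A : comNzRingType) (y : nat -> A) : esym_poly y 0 = 1.
Proof. exact: big_ord0. Qed.

Lemma esym_polyS (A : comNzRingType) (y : nat -> A) N :
  esym_poly y N.+1 = esym_poly y N * (1 + y N *: 'X).
Proof. exact: big_ord_recr. Qed.

Lemma coef_esym_polyZ (A : comNzRingType) (c : A) (y : nat -> A) N l :
  (esym_poly (fun r => c * y r) N)`_l = c ^+ l * (esym_poly y N)`_l.
Proof.
elim: N l => [|N IHN] l.
  by rewrite !esym_poly0 coef1; case: l => [|l]; rewrite ?mulr1 ?mulr0.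
rewrite !esym_polyS !mulrDr !mulr1 -!scalerAr !coefD !coefZ !coefMX !IHN.
by case: l => [|l] /=; rewrite ?exprS; ring.
Qed.

Lemma fps_scaleX_esym_poly (A : comNzRingType) (c : A) (y : nat -> A) N :
  fps_scaleX c (poly_fps (esym_poly y N)) =
  poly_fps (esym_poly (fun r => c * y r) N).
Proof. by apply: fpsP => l; rewrite /= coef_esym_polyZ. Qed.

Lemma coef_expr1DcX (A : comNzRingType) (c : A) n i :
  ((1 + c *: 'X) ^+ n)`_i = 'C(n, i)%:R * c ^+ i.
Proof.
rewrite exprDn (eq_bigr (fun j : 'I_n.+1 => ('C(n, j)%:R * c ^+ j) *: 'X^j)).
  rewrite -(poly_def n.+1 (fun j => 'C(n, j)%:R * c ^+ j)) coef_poly.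
  by case: ltnP => // /bin_small->; rewrite mul0r.
by move=> j _; rewrite expr1n mul1r exprZn -scaler_nat scalerA.
Qed.

Lemma map_esym_poly (A B : comNzRingType) (phi : {rmorphism A -> B})
    (y : nat -> A) N :
  map_poly phi (esym_poly y N) = esym_poly (phi \o y) N.
Proof.
rewrite rmorph_prod; apply: eq_bigr => r _.
by rewrite rmorphD rmorph1 /= map_polyZ map_polyX.
Qed.

Lemma prim_rootV (F : fieldType) m (w : F) :
  m.-primitive_root w -> m.-primitive_root w^-1.
Proof.
move=> wP; have m0 := prim_order_gt0 wP.
have -> : w^-1 = w ^+ m.-1.
  have w0 : w != 0 by rewrite (prim_root_eq0 wP) -lt0n.
  by apply: (mulfI w0); rewrite divff // -exprS prednK // (prim_expr_order wP).
by rewrite prim_root_exp_coprime // -[X in coprime _ X]prednK // coprimenS.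
Qed.

Lemma prod_1B_prim_root (F : fieldType) m (w : F) :
  m.-primitive_root w ->
  \prod_(p < m) (1 - w ^+ p *: 'X) = 1 - 'X^m :> {poly F}.
Proof.
move=> wP; have m0 := prim_order_gt0 wP.
have w0 : w != 0 by rewrite (prim_root_eq0 wP) -lt0n.
pose c := \prod_(p < m) - w ^+ p.
have prodE : \prod_(p < m) (1 - w ^+ p *: 'X) = c *: ('X^m - 1).
  rewrite -(factor_Xn_sub_1 (prim_rootV wP)) big_mkord -scaler_prod.
  apply: eq_bigr => p _.
  rewrite scalerBr !scaleNr opprK -[_ *: _%:P]mul_polyC -polyCM exprVn.
  by rewrite divff ?expf_neq0 // addrC.
have := congr1 (horner^~ 0) prodE.
rewrite horner_prod big1 => [|p _]; last by rewrite !hornerE subr0.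
rewrite !hornerE expr0n gtn_eqF //= sub0r mulrN1 => c1.
by rewrite prodE -[c]opprK -c1 scaleN1r opprB.
Qed.

Lemma prod_esym_poly_prim_root (F : fieldType) m (w : F) (y : nat -> F) N :
  m.-primitive_root w ->
  \prod_(p < m) esym_poly (fun r => - (w ^+ p * y r)) N =
  esym_poly (fun r => - y r ^+ m) N \Po 'X^m.
Proof.
move=> wP; rewrite /esym_poly exchange_big rmorph_prod.
apply: eq_bigr => r _ /=.
rewrite scaleNr comp_polyB (comp_polyC 1) comp_polyZ comp_polyX.
have := congr1 (fun P => P \Po (y r *: 'X)) (prod_1B_prim_root wP).
rewrite rmorph_prod rmorphB rmorph1 /= comp_Xn_poly exprZn => <-.
apply: eq_bigr => p _.
by rewrite comp_polyB (comp_polyC 1) comp_polyZ comp_polyX scalerA scaleNr.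
Qed.

Section CoefficientwiseOrder.
Variable A : numDomainType.
Implicit Types P Q : {poly A}.

Definition coef_nneg_le P Q := forall i, 0 <= P`_i <= Q`_i.

Lemma coef_nneg_leM P P' Q Q' :
  coef_nneg_le P P' -> coef_nneg_le Q Q' -> coef_nneg_le (P * Q) (P' * Q').
Proof.
move=> leP leQ i; rewrite !coefM; apply/andP; split.
  apply: sumr_ge0 => j _; apply: mulr_ge0.
    by have /andP[] := leP j.
  by have /andP[] := leQ (i - j)%N.
apply: ler_sum => j _.
have /andP[P0 lePj] := leP j; have /andP[Q0 leQj] := leQ (i - j)%N.
exact: ler_pM.
Qed.

Lemma coef_nneg_le_prod (I : finType) (P Q : I -> {poly A}) :
  (forall r, coef_nneg_le (P r) (Q r)) ->
  coef_nneg_le (\prod_r P r) (\prod_r Q r).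
Proof.
move=> lePQ; apply: (big_ind2 coef_nneg_le) => [i|P1 Q1 P2 Q2|r _].
- by rewrite coef1 ler0n lexx.
- exact: coef_nneg_leM.
- exact: lePQ.
Qed.

Lemma coef_nneg_le_esym_poly (y z : nat -> A) N :
  (forall r, (r < N)%N -> 0 <= y r <= z r) ->
  coef_nneg_le (esym_poly y N) (esym_poly z N).
Proof.
move=> le_yz; apply: coef_nneg_le_prod => r i.
have /andP[y0 yz] := le_yz r (ltn_ord r); rewrite !coefD !coef1 !coefZ !coefX.
by rewrite lerD2l ler_wpM2r ?addr_ge0 ?mulr_ge0.
Qed.

(* Coefficientwise, [1 + (1 + y) X <= (1 + y X) (1 + X)]. *)
Lemma coef_nneg_le_esym_poly1D (y : nat -> A) N :
  (forall r, (r < N)%N -> 0 <= y r) ->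
  coef_nneg_le (esym_poly (fun r => 1 + y r) N) (esym_poly y N * (1 + 'X) ^+ N).
Proof.
move=> y0; rewrite -[X in _ ^+ X]card_ord -prodr_const -big_split /=.
apply: coef_nneg_le_prod => r i; have yr0 := y0 r (ltn_ord r).
rewrite mulrDr mulr1 !(mulrDl, mul1r) -scalerAl.
rewrite !(coefD, coef1, coefZ, coefX, coefMX).
rewrite [1 + y r]addrC; case: i => [|[|[|i]]] /=;
  by rewrite !(mulr0, mulr1, addr0, add0r) ?lexx ?ler01 ?addr_ge0.
Qed.

End CoefficientwiseOrder.

(** * Euler's product for the sine *)

Section Cotangent.
Variable R : realType.
Implicit Types x : R.

Definition cis x : R[i] := (cos x +i* sin x)%C.

Lemma cisX x n : cis x ^+ n = cis (n%:R * x).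
Proof.
elim: n => [|n IHn]; first by rewrite expr0 mul0r /cis cos0 sin0.
rewrite exprS IHn -natr1 mulrDl mul1r addrC /cis cosD sinD.
by apply/eqP; rewrite eq_complex /= [cos x * sin _ + _]addrC !eqxx.
Qed.

Lemma sin_natpi n : sin (n%:R * pi) = 0 :> R.
Proof.
elim: n => [|n IHn]; first by rewrite mul0r sin0.
by rewrite -natr1 mulrDl mul1r sinDpi IHn oppr0.
Qed.

Lemma expr1D_subr_expr1B (A : comNzRingType) (u : A) N :
  (1 + u) ^+ N.*2.+1 - (1 - u) ^+ N.*2.+1 =
  u * (\sum_(j < N.+1) 'C(N.*2.+1, j.*2.+1)%:R * (u ^+ 2) ^+ j) *+ 2.
Proof.
pose F i := (u ^+ i - (- u) ^+ i) *+ 'C(N.*2.+1, i).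
transitivity (\sum_(i < N.+1.*2) F i).
  rewrite !exprDn -sumrB; apply: eq_bigr => i _.
  by rewrite /F !expr1n !mul1r mulrnBl.
rewrite sum_ord_double mulr_sumr -sumrMnl; apply: eq_bigr => j _.
rewrite /F !(exprS _ j.*2) -mul2n !exprM sqrrN subrr mul0rn add0r.
by rewrite -[LHS]mulr_natl; ring.
Qed.

Definition tan_poly N : {poly R} :=
  \poly_(j < N.+1) 'C(N.*2.+1, j.*2.+1)%:R.

Lemma sin_odd_mul x N : cos x != 0 ->
  sin (N.*2.+1%:R * x) =
  cos x ^+ N.*2.+1 * tan x * (tan_poly N).[- tan x ^+ 2].
Proof.
move=> cx0; set n := N.*2.+1; pose u : R[i] := (0 +i* tan x)%C.
have u2 : u ^+ 2 = (- tan x ^+ 2)%:C%C.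
  by apply/eqP; rewrite eq_complex /=; apply/andP; split; apply/eqP; ring.
have cisE : cis x = (cos x)%:C%C * (1 + u).
  by apply/eqP; rewrite eq_complex /= /tan; apply/andP; split; apply/eqP; field.
have cisNE : cis (- x) = (cos x)%:C%C * (1 - u).
  apply/eqP; rewrite eq_complex /= cosN sinN /tan; apply/andP; split;
    by apply/eqP; field.
have := expr1D_subr_expr1B u N; rewrite -/n u2.
have -> : \sum_(j < N.+1) 'C(n, j.*2.+1)%:R * (- tan x ^+ 2)%:C%C ^+ j =
    ((tan_poly N).[- tan x ^+ 2])%:C%C.
  rewrite horner_poly rmorph_sum; apply: eq_bigr => j _.
  by rewrite rmorphM rmorph_nat rmorphXn.
move=> /(congr1 ( *%R ((cos x)%:C%C ^+ n))).
rewrite mulrBr -!exprMn -cisE -cisNE !cisX mulrN -rmorphXn.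
move/(congr1 (@complex.Im R)); rewrite /cis sinN /=; lra.
Qed.

(* The zeros of [sin ((2N + 1) x)] between [0] and [pi / 2]. *)
Definition theta N r : R := r.+1%:R * pi / N.*2.+1%:R.
Definition thetaV2 N r : R := (theta N r ^+ 2)^-1.
Definition cot2 N r : R := (tan (theta N r) ^+ 2)^-1.

Lemma theta_pihalf N r : (r < N)%N -> 0 < theta N r < pi / 2.
Proof.
move=> rN; apply/andP; split.
  by rewrite divr_gt0 ?mulr_gt0 ?pi_gt0 ?ltr0n.
rewrite /theta ltr_pdivrMr ?ltr0n // mulrAC ltr_pdivlMr ?ltr0n //.
rewrite -mulrA [pi * 2]mulrC mulrA [pi * _]mulrC ltr_pM2r ?pi_gt0 // -natrM.
by rewrite ltr_nat; lia.
Qed.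

Lemma cos_theta_gt0 N r : (r < N)%N -> 0 < cos (theta N r).
Proof. by move=> /theta_pihalf/andP[? ?]; apply: cos_gt0_pihalf; lra. Qed.

Lemma sin_theta_gt0 N r : (r < N)%N -> 0 < sin (theta N r).
Proof. by move=> /theta_pihalf/sin_gt0_pihalf. Qed.

Lemma tan_theta_gt0 N r : (r < N)%N -> 0 < tan (theta N r).
Proof. by move=> rN; rewrite divr_gt0 ?sin_theta_gt0 ?cos_theta_gt0. Qed.

Lemma tan_theta_inj N : {in gtn N &, injective (fun r => tan (theta N r))}.
Proof.
move=> r s rN sN /tan_inj tanE.
have /andP[r0 rpi] := theta_pihalf rN; have /andP[s0 spi] := theta_pihalf sN.
have /eqP : theta N r = theta N s.
  by apply: tanE; rewrite in_itv /=; apply/andP; split; lra.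
rewrite /theta -subr_eq0 -!mulrA -mulrBl !mulf_eq0 invr_eq0 pnatr_eq0 orbF.
by rewrite [pi == 0]gt_eqF ?pi_gt0 // orbF subr_eq0 eqr_nat eqSS => /eqP.
Qed.

Lemma root_tan_poly N r :
  (r < N)%N -> root (tan_poly N) (- tan (theta N r) ^+ 2).
Proof.
move=> rN; have c0 : cos (theta N r) != 0 by rewrite gt_eqF ?cos_theta_gt0.
have := sin_odd_mul N c0; rewrite mulrC divfK ?pnatr_eq0 // sin_natpi.
move/esym/eqP; rewrite -mulrA mulf_eq0 expf_eq0 (negbTE c0) andbF /=.
by rewrite mulf_eq0 (gt_eqF (tan_theta_gt0 rN)).
Qed.

Lemma tan_poly_factor N :
  tan_poly N = \prod_(r < N) ('X + (tan (theta N r) ^+ 2)%:P).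
Proof.
have szP : size (tan_poly N) = N.+1.
  by apply: size_poly_eq; rewrite binn oner_neq0.
have lead1 : lead_coef (tan_poly N) = 1.
  by rewrite lead_coefE szP coef_poly ltnSn binn.
pose roots := [seq - tan (theta N r) ^+ 2 | r <- iota 0 N].
transitivity (\prod_(z <- roots) ('X - z%:P)); last first.
  rewrite big_map -[X in iota 0 X]subn0 big_mkord.
  by apply: eq_bigr => r _; rewrite polyCN opprK.
rewrite -[RHS]scale1r -lead1; apply: all_roots_prod_XsubC.
- by rewrite szP size_map size_iota.
- apply/allP => _ /mapP[r + ->]; rewrite mem_iota => /andP[_ rN].
  exact: root_tan_poly.
rewrite uniq_rootsE map_inj_in_uniq ?iota_uniq // => r s.
rewrite !mem_iota !add0n => rN sN /eqP.
rewrite eqr_opp eqrXn2 // ?ltW ?tan_theta_gt0 // => /eqP.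
exact: tan_theta_inj.
Qed.

Lemma coef_esym_cot2 N l :
  (esym_poly (cot2 N) N)`_l = 'C(N.*2.+1, l.*2.+1)%:R / N.*2.+1%:R.
Proof.
have prod_tan2 : N.*2.+1%:R = \prod_(r < N) tan (theta N r) ^+ 2.
  have : (tan_poly N)`_0 = N.*2.+1%:R by rewrite coef_poly /= bin1.
  rewrite -horner_coef0 tan_poly_factor horner_prod => <-.
  by apply: eq_bigr => r _; rewrite !hornerE.
have -> : 'C(N.*2.+1, l.*2.+1)%:R = (tan_poly N)`_l.
  by rewrite coef_poly; case: ltnP => // Nl; rewrite bin_small //; lia.
have -> : tan_poly N = N.*2.+1%:R *: esym_poly (cot2 N) N.
  rewrite prod_tan2 /esym_poly -scaler_prod tan_poly_factor.
  apply: eq_bigr => r _; rewrite scalerDr scalerA divff ?scale1r.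
    by rewrite addrC -[_ *: 1]mul_polyC mulr1.
  by rewrite expf_neq0 // gt_eqF // tan_theta_gt0.
by rewrite coefZ mulrC mulKf // pnatr_eq0.
Qed.

Lemma sin_le_id x : 0 <= x -> sin x <= x.
Proof.
move=> x0; have [|c _] := MVT_segment x0 (fun y _ => is_derive_sin y).
  by apply: continuous_subspaceT; apply: continuous_sin.
rewrite sin0 !subr0 => ->.
by have := cos_le1 c; nra.
Qed.

Lemma le_id_tan x : 0 <= x < pi / 2 -> x <= tan x.
Proof.
move=> /andP[x0 xpi].
have c0 y : 0 <= y <= x -> 0 < cos y by move=> ?; apply: cos_gt0_pihalf; lra.
have dtan y : y \in `]0, x[%R -> is_derive y 1 tan ((cos y) ^- 2).
  rewrite in_itv /= => yx; apply: is_derive_tan.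
  by rewrite gt_eqF // c0 //; lra.
have [|c] := MVT_segment x0 dtan.
  apply: derivable_within_continuous => y; rewrite in_itv /= => yx.
  by apply: derivable_tan; rewrite gt_eqF // c0.
rewrite in_itv /= tan0 !subr0 => cx ->.
have cc0 : 0 < cos c by apply: c0.
have : 1 <= (cos c) ^- 2.
  by rewrite invf_ge1 ?exprn_gt0 // expr_le1 ?cos_le1 // ltW.
by move: (_ ^- 2) => z; nra.
Qed.

Lemma cot2_ge0 N r : 0 <= cot2 N r.
Proof. by rewrite invr_ge0 sqr_ge0. Qed.

Lemma cot2_le_thetaV2 N r : (r < N)%N -> cot2 N r <= thetaV2 N r.
Proof.
move=> rN; have /andP[x0 xpi] := theta_pihalf rN; have t0 := tan_theta_gt0 rN.
rewrite /cot2 /thetaV2 lef_pV2 ?posrE ?exprn_gt0 //.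
by rewrite ler_sqr ?nnegrE ?(ltW x0) ?(ltW t0) // le_id_tan // ltW.
Qed.

Lemma thetaV2_le_cot2D1 N r : (r < N)%N -> thetaV2 N r <= 1 + cot2 N r.
Proof.
move=> rN; have /andP[x0 _] := theta_pihalf rN; have s0 := sin_theta_gt0 rN.
have -> : 1 + cot2 N r = (sin (theta N r) ^+ 2)^-1.
  rewrite /cot2 /tan exprMn exprVn invfM invrK; set c := cos _; set s := sin _.
  rewrite -[RHS]mul1r -[in RHS](cos2Dsin2 (theta N r)) -/c -/s.
  by field; rewrite gt_eqF.
rewrite /thetaV2 lef_pV2 ?posrE ?exprn_gt0 //.
by rewrite ler_sqr ?nnegrE ?(ltW x0) ?(ltW s0) // sin_le_id // ltW.
Qed.

Lemma coef_esym_thetaV2_bounds N l :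
  (esym_poly (cot2 N) N)`_l <= (esym_poly (thetaV2 N) N)`_l <=
  (esym_poly (cot2 N) N * (1 + 'X) ^+ N)`_l.
Proof.
have lower : coef_nneg_le (esym_poly (cot2 N) N) (esym_poly (thetaV2 N) N).
  by apply: coef_nneg_le_esym_poly => r rN; rewrite cot2_ge0 cot2_le_thetaV2.
have upper : coef_nneg_le (esym_poly (thetaV2 N) N)
    (esym_poly (fun r => 1 + cot2 N r) N).
  apply: coef_nneg_le_esym_poly => r rN.
  by rewrite thetaV2_le_cot2D1 // invr_ge0 sqr_ge0.
have /andP[_ ->] := lower l; have /andP[_ /le_trans->] //= := upper l.
have cot2_ge0N r : (r < N)%N -> 0 <= cot2 N r by rewrite cot2_ge0.
by have /andP[_ ->] := coef_nneg_le_esym_poly1D cot2_ge0N l.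
Qed.

End Cotangent.

Section EulerSine.
Local Open Scope classical_set_scope.
Variable R : realType.

Lemma cvg_double (T : topologicalType) (u : nat -> T) (l : T) :
  u N @[N --> \oo] --> l -> u N.*2 @[N --> \oo] --> l.
Proof.
apply: cvg_comp => A [n _ nA]; exists n => // N /= nN; apply: nA => /=; lia.
Qed.

Lemma cvg_bin_exp q :
  ('C(n.+1, q)%:R / n.+1%:R ^+ q : R) @[n --> \oo] --> (q`!%:R^-1 : R).
Proof.
have cvg_prod : (q`!%:R^-1 * \prod_(i < q) (1 - i%:R * harmonic n) : R)
    @[n --> \oo] --> (q`!%:R^-1 : R).
  rewrite -[X in _ --> X]mulr1; apply: cvgM; first exact: cvg_cst.
  rewrite [X in _ --> X](_ : 1 = \prod_(i < q) (1 : R)); last by rewrite big1.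
  apply: cvg_big => [|i _]; first exact: mul_continuous.
  rewrite -[X in _ --> X]subr0 -(mulr0 (i%:R : R)).
  by apply: cvgB (cvg_cst _) (cvgM (cvg_cst _) cvg_harmonic).
apply: cvg_trans cvg_prod; apply: near_eq_cvg; near=> n.
have le_qn : (q <= n)%N by near: n; exists q.
have -> : 'C(n.+1, q)%:R = q`!%:R^-1 * \prod_(i < q) (n.+1 - i)%:R :> R.
  by rewrite -natr_prod -ffact_prod -bin_ffact natrM mulrC mulfK.
rewrite -mulrA -[X in _ ^+ X]card_ord -prodr_const -prodf_div; congr (_ * _).
apply: eq_bigr => i _; rewrite natrB; last by have := ltn_ord i; lia.
by rewrite mulrBl divff // pnatr_eq0.
Unshelve. all: by end_near.
Qed.

Lemma bin_le_exp n q : ('C(n, q) <= n ^ q)%N.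
Proof.
apply: (@leq_trans ('C(n, q) * q`!)%N); first by rewrite leq_pmulr // fact_gt0.
rewrite bin_ffact ffact_prod -[X in (_ <= n ^ X)%N]card_ord -prod_nat_const.
by apply: leq_prod => i _; apply: leq_subr.
Qed.

Lemma cvg_bin_div_exp2 q :
  ('C(N, q)%:R / N.*2.+1%:R ^+ q.*2 : R) @[N --> \oo] --> ((q == 0)%:R : R).
Proof.
case: q => [|q].
  by under eq_fun do rewrite bin0 expr0 divr1; apply: cvg_cst.
apply: (@squeeze_cvgr _ _ _ _ (fun=> 0) (fun N => @harmonic R N.*2)).
- near=> N; rewrite divr_ge0 ?exprn_ge0 //= ler_pdivrMr ?exprn_gt0 ?ltr0n //.
  rewrite doubleS exprS mulKf ?pnatr_eq0 // -natrX ler_nat.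
  apply: leq_trans (bin_le_exp _ _) _.
  apply: (@leq_trans (N.*2.+1 ^ q.+1)%N); first by rewrite leq_exp2r; lia.
  by rewrite leq_pexp2l //; lia.
- exact: cvg_cst.
- exact: (cvg_double cvg_harmonic).
Unshelve. all: by end_near.
Qed.

Lemma cvg_coef_esym_cot2 l :
  ((esym_poly (cot2 R N) N)`_l / N.*2.+1%:R ^+ l.*2) @[N --> \oo]
    --> (l.*2.+1`!%:R^-1 : R).
Proof.
under eq_fun do rewrite coef_esym_cot2 -mulrA -invfM -exprS.
exact: (cvg_double (@cvg_bin_exp l.*2.+1)).
Qed.

Lemma cvg_coef_esym_thetaV2 l :
  ((esym_poly (thetaV2 R N) N)`_l / N.*2.+1%:R ^+ l.*2)
    @[N --> \oo] --> (l.*2.+1`!%:R^-1 : R).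
Proof.
pose upper N := (esym_poly (cot2 R N) N * (1 + 'X) ^+ N)`_l.
apply: (@squeeze_cvgr _ _ _ _
  (fun N => (esym_poly (cot2 R N) N)`_l / N.*2.+1%:R ^+ l.*2)
  (fun N => upper N / N.*2.+1%:R ^+ l.*2)).
- near=> N; rewrite !ler_pM2r ?invr_gt0 ?exprn_gt0 ?ltr0n //.
  exact: coef_esym_thetaV2_bounds.
- exact: cvg_coef_esym_cot2.
have -> : (l.*2.+1`!%:R^-1 : R) =
    \sum_(j < l.+1) j.*2.+1`!%:R^-1 * ((l - j)%N == 0)%:R.
  rewrite big_ord_recr /= subnn mulr1 big1 ?add0r // => j _.
  by rewrite subn_eq0 leqNgt ltn_ord mulr0.
have -> : (fun N => upper N / N.*2.+1%:R ^+ l.*2) = (fun N => \sum_(j < l.+1)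
    (esym_poly (cot2 R N) N)`_j / N.*2.+1%:R ^+ j.*2 *
    ('C(N, l - j)%:R / N.*2.+1%:R ^+ (l - j).*2)).
  apply/funext => N; rewrite /upper coefM mulr_suml; apply: eq_bigr => j _.
  rewrite -['X]scale1r coef_expr1DcX expr1n mulr1 mulrACA -invfM -exprD.
  by rewrite -doubleD subnKC // -ltnS.
apply: cvg_big => [|j _]; first exact: add_continuous.
by apply: cvgM; [exact: cvg_coef_esym_cot2 | exact: cvg_bin_div_exp2].
Unshelve. all: by end_near.
Qed.

(* [\prod_r (1 + X / r ^ 2) = sinh (pi sqrt X) / (pi sqrt X)]. *)
Lemma cvg_coef_esym_invr2 l :
  ((esym_poly (fun r => harmonic r ^+ 2) N)`_l) @[N --> \oo]
    --> (pi ^+ l.*2 / l.*2.+1`!%:R : R).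
Proof.
have -> : (fun N => (esym_poly (fun r => harmonic r ^+ 2) N)`_l) =
  (fun N => pi ^+ l.*2 *
    ((esym_poly (thetaV2 R N) N)`_l / N.*2.+1%:R ^+ l.*2)).
  apply/funext => N; set n : R := N.*2.+1%:R.
  have n0 : n != 0 by rewrite pnatr_eq0.
  have pi0 : pi != 0 :> R by rewrite gt_eqF ?pi_gt0.
  rewrite mulrCA mulrC -expr_div_n -mul2n exprM -coef_esym_polyZ.
  congr ((esym_poly _ N)`_l); apply/funext => r.
  rewrite /thetaV2 /theta /harmonic -/n -!exprVn -exprMn; congr (_ ^+ 2) => /=.
  by rewrite -[_ * pi / n]mulrA invfM mulrCA divff ?mulr1 ?mulf_neq0 ?invr_eq0.
exact: cvgM (cvg_cst _) (@cvg_coef_esym_thetaV2 l).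
Qed.

End EulerSine.

(** * Generating series of interpolated nested sums *)

Fixpoint compositions (n k : nat) : seq (seq nat) :=
  if n is n'.+1 then
    [seq i.+1 :: s | i <- iota 0 k, s <- compositions n' (k - i.+1)]
  else if k is 0 then [:: [::]] else [::].

Lemma mem_compositions n k s :
  (s \in compositions n k) = [&& size s == n, all (ltn 0) s & sumn s == k].
Proof.
elim: n k s => [|n IHn] k s; first by case: s => [|x s]; case: k.
case: s => [|x s] /=; first by apply/allpairsPdep => -[i [s []]].
apply/allpairsPdep/and3P => [[i [s' []]]|[/eqP sn /andP[x0 s0] /eqP sk]].
  rewrite mem_iota /= add0n IHn => ik /and3P[/eqP <- s'0 /eqP s'k] [-> ->].
  by rewrite eqxx s'0 s'k subnKC.
exists x.-1, s; rewrite prednK // mem_iota IHn s0; split => //; first by lia.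
by case: sn => ->; rewrite -sk addKn !eqxx.
Qed.

Lemma uniq_compositions n k : uniq (compositions n k).
Proof.
elim: n k => [|n IHn] [|k] //.
apply: allpairs_uniq_dep; first exact: iota_uniq.
  by move=> i _; apply: IHn.
by move=> [i s] [j s'] _ _ /= [-> ->].
Qed.

Lemma size_le_sumn s : all (ltn 0) s -> (size s <= sumn s)%N.
Proof. by elim: s => //= x s IHs /andP[x0 /IHs]; lia. Qed.

Lemma compositions_gt n k : (k < n)%N -> compositions n k = [::].
Proof.
move=> kn; case E: compositions => [//|s l].
have := mem_head s l; rewrite -E mem_compositions.
by move=> /and3P[/eqP sn /size_le_sumn + /eqP sk]; rewrite sn sk leqNgt kn.
Qed.

Lemma perm_compositions n k :
  perm_eq (compositions n k)
    [seq [seq (c i : nat) | i : 'I_n] | c : {ffun 'I_n -> 'I_k.+1} in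
      [pred c : {ffun 'I_n -> 'I_k.+1} |
        [forall i, (0 < c i)%N] && (\sum_(i < n) (c i : nat) == k)%N]].
Proof.
apply: uniq_perm; first exact: uniq_compositions.
  rewrite map_inj_uniq ?enum_uniq // => c d /eq_in_map cd.
  by apply/ffunP => i; apply/val_inj/cd; rewrite mem_enum.
move=> s; rewrite mem_compositions.
apply/and3P/mapP => [[/eqP sn s0 /eqP sk]|]; last first.
  case=> c; rewrite mem_enum => /andP[/forallP c0 /eqP ck] ->.
  rewrite size_map size_enum_ord sumnE big_map big_enum /= ck !eqxx.
  by split=> //; apply/allP => _ /mapP[i _ ->]; apply: c0.
have nth_lt i : (nth 0 s i < k.+1)%N.
  have [lt_is|le_si] := ltnP i (size s); last by rewrite nth_default.
  rewrite ltnS -sk sumnE (big_nth 0%N) big_mkord (bigD1 (Ordinal lt_is)) //=.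
  exact: leq_addr.
have sE : s = [seq nth 0%N s i | i : 'I_n].
  apply: (@eq_from_nth _ 0%N); first by rewrite size_map size_enum_ord.
  rewrite sn => i ilt; rewrite (nth_map (Ordinal ilt)) ?size_enum_ord //.
  by rewrite nth_enum_ord.
exists [ffun i : 'I_n => Ordinal (nth_lt i)]; last first.
  by rewrite [LHS]sE; apply: eq_map => i; rewrite ffunE.
rewrite mem_enum; apply/andP; split.
  apply/forallP => i; rewrite ffunE /=.
  by apply: (allP s0); rewrite mem_nth // sn.
rewrite -[X in _ == X]sk sumnE (big_nth 0%N) big_mkord sn.
by apply/eqP/eq_bigr => i _; rewrite ffunE.
Qed.

Section Interpolation.
Variables (K : comNzRingType) (t : K).
Implicit Types (f g : seq nat -> K).

Fixpoint interp_cons f (x : nat) (xs : seq nat) : K :=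
  if xs is y :: ys then
    t * interp_cons f (x + y) ys + interp_cons (fun s => f (x :: s)) y ys
  else f [:: x].

Definition interp f (ks : seq nat) : K :=
  if ks is x :: xs then interp_cons f x xs else f [::].

Lemma sum_tuple_cons (V : nmodType) (T : finType) n (F : n.+1.-tuple T -> V) :
  \sum_b F b = \sum_b \sum_(bs : n.-tuple T) F [tuple of b :: bs].
Proof.
rewrite pair_big /=.
rewrite (reindex (fun p : T * n.-tuple T => [tuple of p.1 :: p.2])) //=.
exists (fun b => (thead b, behead_tuple b)) => [[b bs] _|b _] /=.
  by congr (_, _); apply: val_inj.
by rewrite [RHS]tuple_eta.
Qed.

Lemma size_mzv_merge x xs bs : (size (mzv_merge x xs bs) <= (size xs).+1)%N.
Proof.
elim: xs x bs => [|y ys IHys] x [|b bs] //=.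
by case: b => /=; rewrite ?ltnS // ltnW // ltnS.
Qed.

Lemma interp_consE f x xs :
  interp_cons f x xs = \sum_(b : (size xs).-tuple bool)
    t ^+ ((size xs).+1 - size (mzv_merge x xs b)) * f (mzv_merge x xs b).
Proof.
elim: xs x f => [|y ys IHys] x f /=.
  rewrite (eq_bigr (fun=> f [:: x])) => [|b _].
    by rewrite sumr_const card_tuple.
  by rewrite subnn mul1r.
rewrite sum_tuple_cons big_bool /= !IHys; congr (_ + _).
rewrite mulr_sumr; apply: eq_bigr => b _.
by rewrite mulrA -exprS -subSn // size_mzv_merge.
Qed.

Lemma interpD f g ks :
  interp (fun s => f s + g s) ks = interp f ks + interp g ks.
Proof.
case: ks => //= x xs; elim: xs x f g => //= y ys IHys x f g.
by rewrite !IHys; ring.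
Qed.

Lemma interp_cons_eq0 f x xs :
  (forall y s, f (y :: s) = 0) -> interp_cons f x xs = 0.
Proof.
by elim: xs x f => //= z zs IHzs x f f0; rewrite !IHzs ?mulr0 ?addr0.
Qed.

Lemma interp_consZ c f x xs :
  interp_cons (fun s => c * f s) x xs = c * interp_cons f x xs.
Proof. by elim: xs x f => //= y ys IHys x f; rewrite !IHys; ring. Qed.

Lemma interp_cons_addn c f x y ys :
  (forall z s, f ((x + z)%N :: s) = c * f (z :: s)) ->
  interp_cons f (x + y) ys = c * interp_cons f y ys.
Proof.
move=> fP; elim: ys y => [|z zs IHzs] y /=; first exact: fP.
rewrite -addnA IHzs -[X in _ + X]/(interp_cons (fun s => f (_ :: s)) z zs).
rewrite (_ : (fun s => _) = fun s => c * f (y :: s)); last exact/funext.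
by rewrite interp_consZ; ring.
Qed.

Lemma interp_map_muln a f ks :
  interp f (map (muln a) ks) = interp (fun s => f (map (muln a) s)) ks.
Proof.
case: ks => //= x xs; elim: xs x f => //= y ys IHys x f.
by rewrite -mulnDr !IHys.
Qed.

End Interpolation.

Section GeneratingSeries.
Variables (K : comNzRingType) (t y : K) (q : nat -> K).

(* [q M] stands for [1 / (M + 1)]: the summation index is shifted by one. *)
Fixpoint nested_sum (ks : seq nat) (N : nat) : K :=
  if ks is k :: ks' then \sum_(M < N) q M ^+ k * nested_sum ks' M else 1.

Definition nested_top (ks : seq nat) (N : nat) : K :=
  if ks is k :: ks' then q N ^+ k * nested_sum ks' N else 0.

Lemma nested_sumS ks N :
  nested_sum ks N.+1 = nested_sum ks N + nested_top ks N.
Proof. by case: ks => [|k ks] /=; rewrite ?addr0 // big_ord_recr. Qed.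

Definition interp_sum ks N := interp t (nested_sum^~ N) ks.
Definition interp_top ks N := interp t (nested_top^~ N) ks.

Lemma interp_sumS ks N : interp_sum ks N.+1 = interp_sum ks N + interp_top ks N.
Proof.
rewrite -interpD; congr (interp t _ ks); apply/funext => s.
exact: nested_sumS.
Qed.

Lemma interp_top_cons x s N :
  interp_top (x :: s) N = q N ^+ x * (t * interp_top s N + interp_sum s N).
Proof.
case: s => [|x' s]; first by rewrite /interp_top /interp_sum /= mulr0 add0r.
rewrite /interp_top /= (@interp_cons_addn _ _ (q N ^+ x)) => [|z s'].
  by rewrite interp_consZ mulrDr mulrCA.
by rewrite /= exprD mulrA.
Qed.

Lemma interp_sum0 x s : interp_sum (x :: s) 0 = 0.
Proof. by apply: interp_cons_eq0 => x' s' /=; rewrite big_ord0. Qed.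

Definition composition_sum N n k : K :=
  \sum_(s <- compositions n k) interp_sum s N.
Definition composition_top N n k : K :=
  \sum_(s <- compositions n k) interp_top s N.

Lemma composition_sumS N n k :
  composition_sum N.+1 n k = composition_sum N n k + composition_top N n k.
Proof. by rewrite -big_split; apply: eq_bigr => s _; apply: interp_sumS. Qed.

Lemma composition_topE N n k : composition_top N n.+1 k =
  \sum_(i < k) q N ^+ i.+1 *
    (t * composition_top N n (k - i.+1) + composition_sum N n (k - i.+1)).
Proof.
rewrite /composition_top big_allpairs_dep -[X in iota 0 X]subn0 big_mkord.
apply: eq_bigr => i _; rewrite mulr_sumr -big_split mulr_sumr.
by apply: eq_bigr => s _; apply: interp_top_cons.
Qed.

Lemma composition_topSS N n k :
  composition_top N n.+1 k.+1 =
  q N * (composition_top N n.+1 k +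
         (t * composition_top N n k + composition_sum N n k)).
Proof.
rewrite [LHS]composition_topE big_ord_recl /= expr1 subn1 /= addrC [RHS]mulrDr.
congr (_ + _); rewrite composition_topE mulr_sumr; apply: eq_bigr => i _.
by rewrite mulrA -exprS.
Qed.

Lemma composition_top0 N k : composition_top N 0 k = 0.
Proof. by case: k => [|k]; rewrite /composition_top ?big_nil ?big_seq1. Qed.

(* The second variable [y] is a scalar, so that the coefficients stay in [K],
   where limits make sense; [eq_poly_horner] recovers the powers of [y]. *)
Definition gen_series N : fps K :=
  FPS (fun k => \sum_(n < k.+1) composition_sum N n k * y ^+ n).
Definition gen_top N : fps K :=
  FPS (fun k => \sum_(n < k.+1) composition_top N n k * y ^+ n).

Lemma gen_seriesS N : gen_series N.+1 = gen_series N + gen_top N.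
Proof.
apply: fpsP => k; rewrite fps_coefD -big_split; apply: eq_bigr => n _ /=.
by rewrite composition_sumS mulrDl.
Qed.

Lemma gen_topS N k : gen_top N k.+1 =
  q N * ((1 + t * y) * gen_top N k + y * gen_series N k).
Proof.
have topE : gen_top N k = \sum_(n < k.+1) composition_top N n.+1 k * y ^+ n.+1.
  rewrite /= big_ord_recl composition_top0 mul0r add0r [RHS]big_ord_recr /=.
  rewrite [composition_top N k.+1 k]/composition_top compositions_gt //.
  by rewrite big_nil mul0r addr0.
rewrite mulrDl mul1r {1}topE /= big_ord_recl composition_top0 mul0r add0r.
rewrite !(mulr_sumr, =^~ big_split) /=; apply: eq_bigr => n _.
by rewrite composition_topSS /bump /= add1n exprS; ring.
Qed.

Lemma gen_series_step N :
  gen_series N.+1 * poly_fps (1 + (1 + t * y) * - q N *: 'X) =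
  gen_series N * poly_fps (1 + (1 + t * y - y) * - q N *: 'X).
Proof.
have top0 : gen_top N 0 = 0 by rewrite /= big_ord1 composition_top0 mul0r.
apply: fpsP => -[|k]; rewrite !fps_coefM1DcX gen_seriesS !fps_coefD.
  by rewrite top0 !mulr0 !addr0.
by rewrite gen_topS; ring.
Qed.

Lemma gen_series0 : gen_series 0 = 1.
Proof.
apply: fpsP => -[|k].
  by rewrite /= big_ord1 /composition_sum big_seq1 mulr1.
rewrite /= big1 // => n _; rewrite /composition_sum big_seq big1 ?mul0r //.
move=> [|x s]; rewrite mem_compositions; first by rewrite /= andbF.
by rewrite interp_sum0.
Qed.

Lemma gen_series_mul_esym_poly N :
  gen_series N *
    fps_scaleX (1 + t * y) (poly_fps (esym_poly (fun M => - q M) N)) =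
  fps_scaleX (1 + t * y - y) (poly_fps (esym_poly (fun M => - q M) N)).
Proof.
rewrite !fps_scaleX_esym_poly; elim: N => [|N IHN].
  by rewrite gen_series0 !esym_poly0 mul1r.
by rewrite !esym_polyS !rmorphM mulrCA gen_series_step mulrCA mulrA IHN.
Qed.

End GeneratingSeries.

(** * Passage to the limit *)

Section MzvLimits.
Local Open Scope classical_set_scope.
Variable R : realType.

Lemma cvg_complexR (u : nat -> R) (l : R) :
  u @ \oo --> l -> ((u N)%:C%C : R[i]^o) @[N --> \oo] --> (l%:C%C : R[i]^o).
Proof.
move=> /cvgrPdist_lt ul; apply/cvgrPdist_lt => -[e e'].
rewrite ltcE /= => /andP[/eqP-> /ul]; apply: filterS => N.
by rewrite -rmorphB normc_def /= expr0n addr0 sqrtr_sqr ltcR.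
Qed.

Lemma cvg_interp (K : numFieldType) (t : K) (F : nat -> seq nat -> K)
    (f : seq nat -> K) ks :
  (forall s, all (leq 2) s -> F N s @[N --> \oo] --> f s) ->
  all (leq 2) ks -> interp t (F N) ks @[N --> \oo] --> interp t f ks.
Proof.
case: ks => [|x xs] Ff /=; first exact: (Ff [::]).
elim: xs x F f Ff => [|y ys IHys] x F f Ff /= /andP[x2 ys2].
  by apply: Ff; rewrite /= x2.
have y2 : (2 <= y)%N by case/andP: ys2.
apply: cvgD.
  apply: cvgM; first exact: cvg_cst.
  apply: IHys => //=; case/andP: ys2 => _ ->.
  by rewrite andbT (leq_trans x2) ?leq_addr.
by apply: IHys => // s s2; apply: Ff; rewrite /= x2.
Qed.

Lemma rmorph_nested_sum (A B : comNzRingType) (phi : {rmorphism A -> B})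
    (q : nat -> A) ks N :
  phi (nested_sum q ks N) = nested_sum (phi \o q) ks N.
Proof.
elim: ks N => [|k ks IHks] N /=; first exact: rmorph1.
rewrite rmorph_sum; apply: eq_bigr => M _.
by rewrite rmorphM rmorphXn IHks.
Qed.

Lemma nested_sum_map_muln (A : comNzRingType) (q : nat -> A) a ks N :
  nested_sum q (map (muln a) ks) N = nested_sum (fun M => q M ^+ a) ks N.
Proof.
elim: ks N => //= k ks IHks N; apply: eq_bigr => M _.
by rewrite IHks exprM.
Qed.

Lemma mzv_truncE ks N : mzv_trunc ks N = nested_sum (@harmonic R) ks N.
Proof.
elim: ks N => //= k ks IHks N; rewrite big_add1 big_mkord.
by apply: eq_bigr => M _; rewrite IHks exprVn.
Qed.

Lemma sum_harmonic_sqr_le N : \sum_(M < N) (harmonic M : R) ^+ 2 <= 2.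
Proof.
case: N => [|N]; first by rewrite big_ord0.
apply: (@le_trans _ _ (2 - harmonic N)); last by rewrite gerBl harmonic_ge0.
elim: N => [|N IHN]; first by rewrite big_ord1 /harmonic /= invr1 expr1n; lra.
rewrite big_ord_recr /=; apply: le_trans (lerD IHN (lexx _)) _.
rewrite /harmonic /= -[N.+2%:R]natr1 -subr_ge0.
have : 0 < N.+1%:R :> R by rewrite ltr0n.
move: (N.+1%:R : R) => x x0.
have -> : 2 - (x + 1)^-1 - (2 - x^-1 + (x + 1)^-1 ^+ 2) = (x * (x + 1) ^+ 2)^-1.
  by field; lra.
by rewrite invr_ge0 mulr_ge0 ?sqr_ge0 // ltW.
Qed.

Lemma nested_sum_ge0 (A : numDomainType) (q : nat -> A) ks N :
  (forall M, 0 <= q M) -> 0 <= nested_sum q ks N.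
Proof.
move=> q0; elim: ks N => //= k ks IHks N; apply: sumr_ge0 => M _.
by rewrite mulr_ge0 ?exprn_ge0.
Qed.

Lemma nested_sum_le (A : numDomainType) (q : nat -> A) (b : A) ks N :
  (forall M, 0 <= q M <= 1) -> (forall N, \sum_(M < N) q M ^+ 2 <= b) ->
  all (leq 2) ks -> nested_sum q ks N <= b ^+ size ks.
Proof.
move=> q01 qb.
have q0 M : 0 <= q M by case/andP: (q01 M).
have q1 M : q M <= 1 by case/andP: (q01 M).
have b0 : 0 <= b by have := qb 0%N; rewrite big_ord0.
elim: ks N => //= k ks IHks N /andP[k2 ks2]; rewrite exprS.
apply: (@le_trans _ _ (\sum_(M < N) q M ^+ 2 * b ^+ size ks)).
  apply: ler_sum => M _; apply: ler_pM; rewrite ?exprn_ge0 ?nested_sum_ge0 //.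
    by rewrite ler_wiXn2l.
  exact: IHks.
by rewrite -mulr_suml ler_wpM2r ?exprn_ge0.
Qed.

Lemma cvg_mzv_trunc ks :
  all (leq 2) ks -> (mzv_trunc ks N : R) @[N --> \oo] --> mzv ks.
Proof.
move=> ks2; have : cvgn (fun N => mzv_trunc ks N : R); last exact.
apply: nondecreasing_is_cvgn.
  apply/nondecreasing_seqP => N; rewrite !mzv_truncE nested_sumS lerDl.
  case: ks {ks2} => //= k ks.
  by rewrite mulr_ge0 ?exprn_ge0 ?nested_sum_ge0 // => M; apply: harmonic_ge0.
exists (2 ^+ size ks) => _ [N _ <-]; rewrite mzv_truncE.
apply: nested_sum_le => // [M|]; last exact: sum_harmonic_sqr_le.
by rewrite harmonic_ge0 invf_le1 ?ltr0n // ler1n.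
Qed.

Lemma mzv_tE (t : R[i]) ks :
  mzv_t t ks = interp t (fun s => (mzv s : R)%:C%C) ks.
Proof.
case: ks => [|x xs] /=; last exact/esym/interp_consE.
by rewrite /mzv /= lim_cst.
Qed.

Lemma cvg_interp_sum (t : R[i]) a s : (1 < a)%N -> all (ltn 0) s ->
  interp_sum t (fun M => harmonic M ^+ a) s N @[N --> \oo] -->
  (mzv_t t (map (muln a) s) : R[i]^o).
Proof.
move=> a1 s0; rewrite mzv_tE.
have -> : (fun N => interp_sum t (fun M => harmonic M ^+ a) s N) =
    (fun N => interp t (fun p => (mzv_trunc p N : R)%:C%C) (map (muln a) s)).
  apply/funext => N; rewrite interp_map_muln; congr (interp t _ s).
  apply/funext => p; rewrite mzv_truncE rmorph_nested_sum nested_sum_map_muln.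
  congr (nested_sum _ p N); apply/funext => M /=.
  by rewrite fmorphV rmorph_nat.
apply: cvg_interp => [p p2|]; first exact/cvg_complexR/cvg_mzv_trunc.
rewrite all_map; apply: sub_all s0 => x x0 /=.
by rewrite (leq_trans a1) ?leq_pmulr.
Qed.

End MzvLimits.

Section SineProduct.
Local Open Scope classical_set_scope.
Variable R : realType.

Lemma rho_prim_root m : (0 < m)%N -> m.-primitive_root (rho m ^+ 2 : R[i]).
Proof.
move=> m0; have mR : 0 < m%:R :> R by rewrite ltr0n.
have rhoX j : (rho m ^+ 2) ^+ j = cis (j%:R * pi / m%:R *+ 2) :> R[i].
  rewrite -exprM -[rho m]/(cis (pi / m%:R)) cisX; congr cis.
  by rewrite natrM -mulr_natr; ring.
apply/andP; split=> //; apply/forallP => i; apply/eqP.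
rewrite unity_rootE rhoX; have ilt := ltn_ord i.
have [im|im] := eqVneq i.+1 m.
  by rewrite im [_ * pi]mulrC mulfK ?(lt0r_neq0 mR) // /cis cos2pi sin2pi eqxx.
apply/negbTE; rewrite eq_complex negb_and /= cos_mulr2n cos2sin2.
apply/orP; left.
have s0 : 0 < sin (i.+1%:R * pi / m%:R : R).
  apply: sin_gt0_pi; rewrite divr_gt0 ?mulr_gt0 ?pi_gt0 ?ltr0n //=.
  rewrite ltr_pdivrMr // mulrC ltr_pM2l ?pi_gt0 // ltr_nat.
  by rewrite ltn_neqAle im.
by rewrite lt_eqF //; nra.
Qed.

(* The expansions of [sin (pi sqrt v) / (pi sqrt v)] and of its inverse. *)
Definition sine_fps : fps R[i] :=
  fps_scaleX (lambda ^+ 2 / 4) (map_fps ratr sinhc_fps).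
Definition cosecant_fps : fps R[i] :=
  fps_scaleX (lambda ^+ 2 / 4) (map_fps ratr cosechc_fps).

Lemma mul_sine_cosecant : sine_fps * cosecant_fps = 1.
Proof. by rewrite -rmorphM -map_fpsM mul_sinhc_cosechc map_fps1 rmorph1. Qed.

Lemma lambda2_div4 : lambda ^+ 2 / 4 = (- pi ^+ 2)%:C%C :> R[i].
Proof.
have -> : lambda ^+ 2 = (- pi ^+ 2)%:C%C * 4 :> R[i].
  rewrite -[4](rmorph_nat (real_complex R)).
  by apply/eqP; rewrite eq_complex /=; apply/andP; split; apply/eqP; ring.
by rewrite mulfK // pnatr_eq0.
Qed.

Lemma cvg_sine_fps :
  fps_cvg (fun N => poly_fps (esym_poly (fun r => - harmonic r ^+ 2) N))
    sine_fps.
Proof.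
move=> l.
have -> : sine_fps l = (-1) ^+ l * (pi ^+ l.*2 / l.*2.+1`!%:R : R)%:C%C.
  rewrite /= lambda2_div4 fmorphV rmorph_nat rmorphM fmorphV rmorph_nat mulrA.
  congr (_ / _).
  by rewrite -rmorphXn [in LHS]exprNn -exprM mul2n rmorphM rmorph_sign.
have coef_negE N : poly_fps (esym_poly (fun r => - harmonic r ^+ 2) N) l =
    (-1) ^+ l * ((esym_poly (fun r => harmonic r ^+ 2) N)`_l)%:C%C :> R[i].
  rewrite -coef_map map_esym_poly -coef_esym_polyZ /=.
  congr ((esym_poly _ N)`_l); apply/funext => r /=.
  by rewrite mulN1r rmorphXn fmorphV rmorph_nat.
under eq_fun do rewrite coef_negE.
exact: cvgM (cvg_cst _) (cvg_complexR (@cvg_coef_esym_invr2 R l)).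
Qed.

Variable m : nat.
Hypothesis m_gt0 : (0 < m)%N.
Local Notation rho2 := (rho m ^+ 2 : R[i]).

(* The partial products of [A]. *)
Definition sineprod_poly N : {poly R[i]} :=
  esym_poly (fun r => - harmonic r ^+ (2 * m)) N.

Lemma fps_twist_sine_poly N :
  fps_twist m rho2 (poly_fps (esym_poly (fun r => - harmonic r ^+ 2) N)) =
  poly_fps (sineprod_poly N \Po 'X^m).
Proof.
have -> : sineprod_poly N = esym_poly (fun r => - (harmonic r ^+ 2) ^+ m) N.
  by congr (esym_poly _ N); apply/funext => r; rewrite exprM.
rewrite -(prod_esym_poly_prim_root _ _ (rho_prim_root m_gt0)) [RHS]rmorph_prod.
apply: eq_bigr => p _; rewrite fps_scaleX_esym_poly.
by congr (poly_fps (esym_poly _ N)); apply/funext => r; rewrite mulrN.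
Qed.

Lemma cvg_twist_sine D :
  (if (m %| D)%N then (sineprod_poly N)`_(D %/ m) else 0) @[N --> \oo] -->
  (fps_twist m rho2 sine_fps D : R[i]^o).
Proof.
under eq_fun do rewrite -coef_comp_poly_Xn // -[_`_D]/(poly_fps _ D).
under eq_fun do rewrite -fps_twist_sine_poly.
by apply: fps_cvg_prod => p; apply/fps_cvg_scaleX/cvg_sine_fps.
Qed.

Lemma twist_sine_eq0 D : ~~ (m %| D)%N -> fps_twist m rho2 sine_fps D = 0.
Proof.
move=> mD; have := cvg_twist_sine (D := D); rewrite (negbTE mD) => cvg0.
by apply: (@cvg_unique R[i]^o) cvg0 (cvg_cst _).
Qed.

Definition sineprod : fps R[i] :=
  fps_multisection m (fps_twist m rho2 sine_fps).
Definition sineprodV : fps R[i] :=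
  fps_multisection m (fps_twist m rho2 cosecant_fps).

Lemma mul_sineprodV : sineprod * sineprodV = 1.
Proof.
rewrite -fps_multisectionM -?fps_twistM ?mul_sine_cosecant ?fps_twist1 //.
  exact: fps_multisection1.
exact: twist_sine_eq0.
Qed.

Lemma cvg_sineprod : fps_cvg (fun N => poly_fps (sineprod_poly N)) sineprod.
Proof.
by move=> j; have := @cvg_twist_sine (m * j); rewrite dvdn_mulr // mulKn.
Qed.

End SineProduct.

Arguments sineprod_poly {R} m.
Arguments sineprod {R} m.
Arguments sineprodV {R} m.

(** * The restricted sum formula *)

Lemma eq_poly_horner (F : numDomainType) (p q : {poly F}) :
  (forall x, p.[x] = q.[x]) -> p = q.
Proof.
move=> pq; apply/eqP; rewrite -subr_eq0; apply/eqP.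
apply: (@roots_geq_poly_eq0 _ _ [seq i%:R | i <- iota 0 (size (p - q))]).
- by apply/allP => _ /mapP[i _ ->]; rewrite rootE !hornerE pq subrr.
- by rewrite map_inj_uniq ?iota_uniq //; apply: mulrIn; apply: oner_neq0.
- by rewrite size_map size_iota.
Qed.

Lemma coef_exprBX_expr (A : comNzRingType) (t : A) i j n :
  ((1 + t *: 'X - 'X) ^+ i * (1 + t *: 'X) ^+ j)`_n =
  \sum_(u < n.+1)
    'C(i, u)%:R * (-1) ^+ u * 'C(i + j - u, n - u)%:R * t ^+ (n - u).
Proof.
set s := 1 + t *: 'X.
pose F u := 'C(i, u)%:R * (-1) ^+ u * 'C(i + j - u, n - u)%:R * t ^+ (n - u).
transitivity (\sum_(u < i.+1 | (u <= n)%N) F u).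
  rewrite exprBn mulr_suml coef_sum [RHS]big_mkcond; apply: eq_bigr => u _.
  have ui : (u <= i)%N by rewrite -ltnS.
  have -> : (-1) ^+ u * s ^+ (i - u) * 'X^u *+ 'C(i, u) * s ^+ j =
      ('C(i, u)%:R * (-1) ^+ u) *: (s ^+ (i + j - u) * 'X^u).
    rewrite addnC -addnBA // exprD -mul_polyC polyCM rmorph_nat rmorph_sign.
    by rewrite -mulr_natl; ring.
  rewrite coefZ coefMXn coef_expr1DcX ltnNge.
  by case: leqP; rewrite ?mulr0 ?mulrA.
rewrite (big_ord_widen_cond (i + n).+1 (fun u => u <= n)%N F); last by lia.
rewrite [RHS](big_ord_widen (i + n).+1 F); last by lia.
rewrite big_mkcond [RHS]big_mkcond; apply: eq_bigr => u _; rewrite !ltnS.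
case: (leqP u i) => [_|/bin_small iu]; first by rewrite andbT.
by rewrite andbF /F iu !mul0r if_same.
Qed.

Lemma coef_sum_exprBX_expr (A : comNzRingType) (t : A) (a : nat -> A) k n :
  (\sum_(j < k.+1) a j *:
     ((1 + t *: 'X - 'X) ^+ (k - j) * (1 + t *: 'X) ^+ j))`_n =
  \sum_(i < n.+1) (\sum_(j < k.+1) 'C(k - j, i)%:R * a j)
      * (-1) ^+ i * 'C(k - i, n - i)%:R * t ^+ (n - i).
Proof.
rewrite coef_sum.
under eq_bigr => j _ do rewrite coefZ coef_exprBX_expr mulr_sumr.
rewrite exchange_big; apply: eq_bigr => i _.
rewrite !mulr_suml; apply: eq_bigr => j _.
have le_jk : (j <= k)%N by rewrite -ltnS.
by rewrite subnK //; ring.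
Qed.

Lemma sum_binB_widen (A : pzSemiRingType) (a : nat -> A) i k :
  \sum_(j < k.+1) 'C(k - j, i)%:R * a j =
  \sum_(j < (k - i).+1) 'C(k - j, i)%:R * a j.
Proof.
rewrite [RHS](big_ord_widen k.+1 (fun j => 'C(k - j, i)%:R * a j)); last by lia.
rewrite [RHS]big_mkcond; apply: eq_bigr => j _; case: ltnP => // ji.
by rewrite bin_small ?mul0r //; have := ltn_ord j; lia.
Qed.

Section RestrictedSum.
Variables (R : realType) (m : nat) (t : R[i]).
Hypothesis m_gt0 : (0 < m)%N.
Local Notation A := (sineprod m : fps R[i]).
Local Notation Ainv := (sineprodV m : fps R[i]).

Definition mzv_sum n k : R[i] :=
  \sum_(c <- compositions n k) mzv_t t (map (muln (2 * m)) c).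

Definition mzv_gen y : fps R[i] :=
  FPS (fun k => \sum_(n < k.+1) mzv_sum n k * y ^+ n).

Lemma cvg_gen_series y :
  fps_cvg (gen_series t y (fun M => harmonic M ^+ (2 * m))) (mzv_gen y).
Proof.
move=> k; apply: cvg_big => [|n _]; first exact: add_continuous.
apply: cvgM; last exact: cvg_cst.
rewrite /composition_sum /mzv_sum big_seq.
under eq_fun do rewrite big_seq.
apply: cvg_big => [|s]; first exact: add_continuous.
rewrite mem_compositions => /and3P[_ s_gt0 _].
by apply: cvg_interp_sum s_gt0; lia.
Qed.

Lemma mzv_gen_mul_sineprod y :
  mzv_gen y * fps_scaleX (1 + t * y) A = fps_scaleX (1 + t * y - y) A.
Proof.
have := fps_cvg_scaleX (c := 1 + t * y - y) (@cvg_sineprod R m m_gt0).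
under eq_fun do rewrite -gen_series_mul_esym_poly.
apply: fps_cvg_unique; apply: fps_cvgM; first exact: cvg_gen_series.
exact/fps_cvg_scaleX/cvg_sineprod.
Qed.

Lemma mzv_genE y :
  mzv_gen y = fps_scaleX (1 + t * y) Ainv * fps_scaleX (1 + t * y - y) A.
Proof.
rewrite -mzv_gen_mul_sineprod mulrCA -rmorphM [Ainv * A]mulrC mul_sineprodV //.
by rewrite rmorph1 mulr1.
Qed.

Lemma poly_mzv_sumE k : \poly_(n < k.+1) mzv_sum n k =
  \sum_(j < k.+1) (A (k - j)%N * Ainv j) *:
    ((1 + t *: 'X - 'X) ^+ (k - j) * (1 + t *: 'X) ^+ j).
Proof.
apply: eq_poly_horner => y; rewrite horner_poly -[LHS]/(mzv_gen y k) mzv_genE.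
rewrite horner_sum; apply: eq_bigr => j _.
rewrite !fps_coef_scaleX mulrC mulrACA mulrC hornerZ hornerM !horner_exp.
by rewrite !(hornerD, hornerN, hornerZ, hornerX, hornerC).
Qed.

Lemma mzv_sumE n k : (0 < k)%N -> mzv_sum n k =
  \sum_(1 <= i < n.+1)
    (\sum_(0 <= j < (k - i).+1) 'C(k - j, i)%:R * (A (k - j)%N * Ainv j))
    * (-1) ^+ i * 'C(k - i, n - i)%:R * t ^+ (n - i).
Proof.
move=> k_gt0.
have -> : mzv_sum n k = (\poly_(n < k.+1) mzv_sum n k)`_n.
  rewrite coef_poly; case: ltnP => // kn.
  by rewrite /mzv_sum compositions_gt ?big_nil.
rewrite poly_mzv_sumE (coef_sum_exprBX_expr _ (fun j => A (k - j)%N * Ainv j)).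
have sum0 : \sum_(j < k.+1) 'C(k - j, 0)%:R * (A (k - j)%N * Ainv j) = 0.
  transitivity ((Ainv * A) k).
    by rewrite fps_coefM; apply: eq_bigr => j _; rewrite bin0 mul1r mulrC.
  by rewrite mulrC mul_sineprodV // fps_coef1 gtn_eqF.
rewrite big_ord_recl sum0 !mul0r add0r big_add1 big_mkord.
apply: eq_bigr => i _; rewrite lift0; congr (_ * _ * _ * _).
rewrite big_mkord; exact: (sum_binB_widen (fun j => A (k - j)%N * Ainv j)).
Qed.

Lemma coef_sineprodM_sineprodV k j : (j <= k)%N ->
  A (k - j)%N * Ainv j =
  (\sum_(np : {ffun 'I_m -> 'I_(m * j).+1} |
      (\sum_(p < m) (np p : nat))%N == (m * j)%N)
    \sum_(lp : {ffun 'I_m -> 'I_(m * (k - j)).+1} |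
      (\sum_(p < m) (lp p : nat))%N == (m * (k - j))%N)
      ((\prod_(p < m)
          ratr (beta2 (np p) /
                (((2 * np p)`!)%:R * ((2 * lp p).+1`!)%:R)) : R[i]) *
       rho m ^+ (\sum_(p < m) 2 * p * (np p + lp p))%N)) *
  (lambda ^+ (2 * k * m) / ((4 ^ (k * m))%:R)).
Proof.
move=> jk; set z : R[i] := lambda ^+ 2 / 4.
have -> : lambda ^+ (2 * k * m) / (4 ^ (k * m))%:R =
    z ^+ (m * (k - j)) * z ^+ (m * j).
  rewrite -exprD -mulnDr subnK // /z expr_div_n -exprM natrX.
  by rewrite -mulnA [(m * k)%N]mulnC.
rewrite mulrC /= !fps_coef_prod big_distrlr /= mulr_suml.
apply: eq_bigr => np /eqP npE; rewrite mulr_suml; apply: eq_bigr => lp /eqP lpE.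
rewrite -[X in z ^+ X]lpE -[X in _ * z ^+ X]npE -!prodrXr -!big_split /=.
apply: eq_bigr => p _; rewrite /= -/z mulnDr exprD !exprM -!mul2n.
rewrite invfM mulrA [in RHS]rmorphM /=.
by move: (z ^+ _) (z ^+ _) (_ ^+ np p) (_ ^+ lp p) => *; ring.
Qed.

End RestrictedSum.

Theorem theorem4p12 (R : realType) (k n m : nat) (t : R[i]) :
  (0 < n)%N -> (0 < m)%N -> (n <= k)%N ->
  \sum_(c : {ffun 'I_n -> 'I_k.+1} |
          [forall i, (0 < c i)%N] && ((\sum_(i < n) (c i : nat))%N == k))
     mzv_t t [seq (2 * m * c i)%N | i : 'I_n]
  =
  (\sum_(1 <= i < n.+1)
     (\sum_(0 <= j < (k - i).+1)
        ('C(k - j, i))%:R *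
        \sum_(np : {ffun 'I_m -> 'I_(m * j).+1} |
                (\sum_(p < m) (np p : nat))%N == (m * j)%N)
        \sum_(lp : {ffun 'I_m -> 'I_(m * (k - j)).+1} |
                (\sum_(p < m) (lp p : nat))%N == (m * (k - j))%N)
          ((\prod_(p < m)
               ratr (beta2 (np p) /
                     (((2 * np p)`!)%:R * ((2 * lp p).+1`!)%:R)) : R[i]) *
           rho m ^+ (\sum_(p < m) 2 * p * (np p + lp p))%N))
     * (-1) ^+ i * ('C(k - i, k - n))%:R * t ^+ (n - i))
  * lambda ^+ (2 * k * m) / ((4 ^ (k * m))%:R).
Proof.
move=> n_gt0 m_gt0 le_nk.
transitivity (mzv_sum m t n k).
  rewrite /mzv_sum (perm_big _ (perm_compositions n k)) big_image.
  by apply: eq_bigr => c _; rewrite /image_mem -map_comp.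
rewrite mzv_sumE //; last exact: leq_trans le_nk.
rewrite -mulrA mulr_suml; apply: eq_big_nat => i /andP[i_gt0 le_in].
have -> : 'C(k - i, k - n) = 'C(k - i, n - i).
  by rewrite -bin_sub; [congr 'C(_, _); lia | lia].
set L := lambda ^+ _ / _.
rewrite -!(mulrAC _ L); congr (_ * _ * _ * _); rewrite mulr_suml.
apply: eq_big_nat => j /andP[_ le_j].
by rewrite -mulrA coef_sineprodM_sineprodV //; lia.
Qed.
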